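(* Let $x=\varphi_1(u,v)$, $y=\varphi_2(u,v)$ be a smooth diffeomorphism $\Phi$ from an open set $U\subset\mathbb{R}^2$ onto its image, with inverse $u=\psi_1(x,y)$, $v=\psi_2(x,y)$, and set $\Xi=\varphi_{1,u}\varphi_{2,v}-\varphi_{1,v}\varphi_{2,u}$, where $\varphi_{i,u}=\partial\varphi_i/\partial u$ and $\varphi_{i,v}=\partial\varphi_i/\partial v$. Let $b_A(t),b_B(t)$ be continuous real functions on an interval containing $a$. Then, in the coordinates $(u,v)$, the linear system $$\frac{\mathrm{d} x}{\mathrm{d} t}=b_A(t)\,x,\qquad \frac{\mathrm{d} y}{\mathrm{d} t}=-b_A(t)\,y+b_B(t)$$ takes the form $$\frac{\mathrm{d}u}{\mathrm{d}t}=\frac{b_A(t)}{\Xi}\left(\varphi_{1,v}\varphi_{2}+\varphi_{1}\varphi_{2,v}\right)-\frac{b_B(t)}{\Xi}\varphi_{1,v},\qquad \frac{\mathrm{d}v}{\mathrm{d}t}=-\frac{b_A(t)}{\Xi}\left(\varphi_{1,u}\varphi_{2}+\varphi_{1}\varphi_{2,u}\right)+\frac{b_B(t)}{\Xi}\varphi_{1,u},$$ and the general solution of this system in $(u,v)$ is $$u(t)=\psi_1(x(t),y(t)),\qquad v(t)=\psi_2(x(t),y(t)),$$ with $$x(t)=c_1\,\mathrm{e}^{\gamma(t)},\qquad y(t)=\left(c_2+\int_a^t \mathrm{e}^{\gamma(s)}b_B(s)\,\mathrm{d}s\right)\mathrm{e}^{-\gamma(t)},\qquad \gamma(t)=\int_a^t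 b_A(s)\,\mathrm{d}s,$$ where $c_1,c_2$ are real constants determined by the initial conditions (as long as $(x(t),y(t))$ remains in $\Phi(U)$). *)

(* Defs.v *)
From Stdlib Require Import Reals.
From Coquelicot Require Import Coquelicot.

Open Scope R_scope.

(** Any interval: bounded or not, with or without its endpoints. *)
Definition is_interval (J : R -> Prop) : Prop :=
  forall r s t : R, J r -> J t -> r <= s <= t -> J s.

(** [is_derive] with the point restricted to [J]: the ordinary derivative at
    interior points of [J], the one-sided derivative at an endpoint. *)
Definition is_derive_within (J : R -> Prop) (f : R -> R) (t l : R) : Prop :=
  filterdiff f (within J (locally t)) (fun h => scal h l).

(** C^infinity on a subset [A] of the plane: near each point of [A], [f] agrees
    on [A] with a function all of whose iterated partial derivatives exist and
    are continuous on an open set.  For open [A] this is the usual notion; for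
    general [A] it does not depend on the values of [f] outside [A]. *)
Definition smooth_on (A : R * R -> Prop) (f : R -> R -> R) : Prop :=
  forall p : R * R, A p ->
    exists (W : R * R -> Prop) (g : R -> R -> R),
      open W /\ W p /\
      (forall (n : nat) (x y : R), W (x, y) -> ex_diff_n g n x y) /\
      (forall x y : R, W (x, y) -> A (x, y) -> f x y = g x y).

Definition image2 (U : R * R -> Prop) (phi1 phi2 : R -> R -> R) (p : R * R)
  : Prop :=
  exists u v : R, U (u, v) /\ p = (phi1 u v, phi2 u v).

(** [(psi1, psi2)] matters only on the image of [U]. *)
Definition diffeo_onto_image (U : R * R -> Prop)
    (phi1 phi2 psi1 psi2 : R -> R -> R) : Prop :=
  open U /\
  smooth_on U phi1 /\ smooth_on U phi2 /\
  smooth_on (image2 U phi1 phi2) psi1 /\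
  smooth_on (image2 U phi1 phi2) psi2 /\
  (forall u v : R, U (u, v) ->
     psi1 (phi1 u v) (phi2 u v) = u /\ psi2 (phi1 u v) (phi2 u v) = v).

Definition d_u (f : R -> R -> R) (u v : R) : R := Derive (fun z => f z v) u.
Definition d_v (f : R -> R -> R) (u v : R) : R := Derive (fun z => f u z) v.

Definition Xi (phi1 phi2 : R -> R -> R) (u v : R) : R :=
  d_u phi1 u v * d_v phi2 u v - d_v phi1 u v * d_u phi2 u v.

Definition solves_xy (bA bB : R -> R) (J : R -> Prop) (x y : R -> R) : Prop :=
  forall t : R, J t ->
    is_derive_within J x t (bA t * x t) /\
    is_derive_within J y t (- bA t * y t + bB t).

Definition rhs_u (phi1 phi2 : R -> R -> R) (bA bB : R -> R) (t u v : R) : R :=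
  bA t / Xi phi1 phi2 u v *
    (d_v phi1 u v * phi2 u v + phi1 u v * d_v phi2 u v)
  - bB t / Xi phi1 phi2 u v * d_v phi1 u v.

Definition rhs_v (phi1 phi2 : R -> R -> R) (bA bB : R -> R) (t u v : R) : R :=
  - (bA t / Xi phi1 phi2 u v) *
    (d_u phi1 u v * phi2 u v + phi1 u v * d_u phi2 u v)
  + bB t / Xi phi1 phi2 u v * d_u phi1 u v.

Definition solves_uv (U : R * R -> Prop) (phi1 phi2 : R -> R -> R)
    (bA bB : R -> R) (J : R -> Prop) (u v : R -> R) : Prop :=
  forall t : R, J t ->
    U (u t, v t) /\
    is_derive_within J u t (rhs_u phi1 phi2 bA bB t (u t) (v t)) /\
    is_derive_within J v t (rhs_v phi1 phi2 bA bB t (u t) (v t)).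

Definition gam (bA : R -> R) (a t : R) : R := RInt bA a t.

Definition x_sol (bA : R -> R) (a c1 t : R) : R := c1 * exp (gam bA a t).

Definition y_sol (bA bB : R -> R) (a c2 t : R) : R :=
  (c2 + RInt (fun s => exp (gam bA a s) * bB s) a t) * exp (- gam bA a t).

(* Main.v *)
Require Import Defs.
From Stdlib Require Import Reals Lra Classical.
From Coquelicot Require Import Coquelicot.

Open Scope R_scope.

(** The system in [(u, v)] is the pullback of the linear system by [Phi]: the chain
    rule applied to [psi o Phi = id] makes the Jacobian of [Phi] invertible, and
    [rhs_u], [rhs_v] are the entries of [(D Phi)^-1] applied to the linear vector field.
    The linear system is solved by the first integrals [x e^{-gamma}] and
    [y e^{gamma} - int e^{gamma} bB], whose derivatives vanish along solutions.
    All derivatives are relative to an interval that may contain its endpoints, so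
    the mean value theorem and integrability, which Coquelicot states for two-sided
    neighbourhoods, are applied to functions composed with a clamp onto a segment. *)

(** * Derivatives relative to a subset of the line *)

(** [filterdiff] asks for its estimate at every limit of the filter. Since [t] lies in [J], every
    set of [within J (locally t)] contains [t] in its trace on [J], so the only limit is [t] itself
    and a single estimate remains. *)
Lemma is_derive_withinP (J : R -> Prop) (f : R -> R) (t l : R) :
  J t ->
  (is_derive_within J f t l <->
   forall eps : posreal, within J (locally t)
     (fun s => Rabs (f s - f t - (s - t) * l) <= eps * Rabs (s - t))).
Proof.
  intros Jt; split.
  - intros [_ H] eps.
    refine (H t _ eps).
    intros P HP; apply filter_le_within; exact HP.
  - intros H; split.
    + apply (@is_linear_scal_l R_AbsRing R_NormedModule l).
    + intros x Hx.
      assert (x = t) as ->.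
      { apply NNPP; intros n.
        assert (Hd : 0 < Rabs (t - x)) by (apply Rabs_pos_lt; lra).
        assert (Hn : locally x (fun s => s <> t)).
        { exists (mkposreal _ Hd); intros s Hs ->.
          change (Rabs (t - x) < Rabs (t - x)) in Hs; lra. }
        apply Hx in Hn.
        exact (locally_singleton t _ Hn Jt eq_refl). }
      exact H.
Qed.

Lemma within_self (J : R -> Prop) (t : R) (P : R -> Prop) :
  (forall s, J s -> P s) -> within J (locally t) P.
Proof. intros H; exists (mkposreal 1 Rlt_0_1); intros s _; apply H. Qed.

Lemma is_derive_within_ext_loc (J : R -> Prop) (f g : R -> R) (t l : R) :
  J t -> within J (locally t) (fun s => f s = g s) ->
  is_derive_within J f t l -> is_derive_within J g t l.
Proof.
  intros Jt He Hf; apply is_derive_withinP; [exact Jt|]; intros eps.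
  assert (E : f t = g t) by exact (locally_singleton t _ He Jt).
  generalize (proj1 (is_derive_withinP J f t l Jt) Hf eps); intros H.
  generalize (filter_and _ _ He H); apply filter_imp.
  intros s [<- Hs]; rewrite <- E; exact Hs.
Qed.

Lemma is_derive_within_ext (J : R -> Prop) (f g : R -> R) (t l : R) :
  J t -> (forall s, J s -> f s = g s) ->
  is_derive_within J f t l -> is_derive_within J g t l.
Proof.
  intros Jt H; apply is_derive_within_ext_loc; [exact Jt|].
  now apply within_self.
Qed.

Lemma is_derive_within_subset (I J : R -> Prop) (f : R -> R) (t l : R) :
  J t -> (forall s, J s -> I s) ->
  is_derive_within I f t l -> is_derive_within J f t l.
Proof.
  intros Jt HJ Hf; apply is_derive_withinP; [exact Jt|]; intros eps.
  generalize (proj1 (is_derive_withinP I f t l (HJ t Jt)) Hf eps).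
  unfold within; apply filter_imp; auto.
Qed.

Lemma is_derive_within_of_is_derive (J : R -> Prop) (f : R -> R) (t l : R) :
  J t -> is_derive f t l -> is_derive_within J f t l.
Proof.
  intros Jt [Hl Hf]; apply is_derive_withinP; [exact Jt|]; intros eps.
  apply filter_le_within.
  refine (Hf t _ eps); intros P HP; exact HP.
Qed.

Lemma is_derive_of_within (J : R -> Prop) (f : R -> R) (t l : R) :
  locally t J -> is_derive_within J f t l -> is_derive f t l.
Proof.
  intros HJ Hf.
  assert (Jt := locally_singleton _ _ HJ).
  split; [apply (@is_linear_scal_l R_AbsRing R_NormedModule l)|].
  intros x Hx; rewrite <- (is_filter_lim_locally_unique t x Hx) in *.
  intros eps.
  generalize (filter_and _ _ HJ (proj1 (is_derive_withinP J f t l Jt) Hf eps)).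
  apply filter_imp; intros s [Js Hs]; exact (Hs Js).
Qed.

(** This is the defining estimate with [eps = 1]. It yields continuity and bounds the increments in
    the chain rule. *)
Lemma is_derive_within_lipschitz (J : R -> Prop) (f : R -> R) (t l : R) :
  J t -> is_derive_within J f t l ->
  within J (locally t) (fun s => Rabs (f s - f t) <= (Rabs l + 1) * Rabs (s - t)).
Proof.
  intros Jt Hf.
  generalize (proj1 (is_derive_withinP J f t l Jt) Hf (mkposreal 1 Rlt_0_1)).
  apply filter_imp; simpl; intros s Hs.
  replace (f s - f t) with ((f s - f t - (s - t) * l) + l * (s - t)) by ring.
  eapply Rle_trans; [apply Rabs_triang|]; rewrite (Rabs_mult l); lra.
Qed.

Lemma is_derive_within_continuous (J : R -> Prop) (f : R -> R) (t l : R) :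
  J t -> is_derive_within J f t l ->
  filterlim f (within J (locally t)) (locally (f t)).
Proof.
  intros Jt Hf; apply filterlim_locally; intros eps.
  assert (Hl := is_derive_within_lipschitz _ _ _ _ Jt Hf).
  assert (P : 0 < Rabs l + 1) by (generalize (Rabs_pos l); lra).
  assert (Hd : 0 < eps / (Rabs l + 1))
    by (apply Rdiv_lt_0_compat; [apply cond_pos | exact P]).
  assert (Hb : within J (locally t) (fun s => Rabs (s - t) < eps / (Rabs l + 1))).
  { apply filter_le_within; exists (mkposreal _ Hd); intros s Hs; exact Hs. }
  generalize (filter_and _ _ Hl Hb); apply filter_imp.
  intros s [H1 H2]; change (Rabs (f s - f t) < eps).
  apply Rle_lt_trans with (1 := H1).
  apply (Rmult_lt_compat_l _ _ _ P) in H2.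
  replace ((Rabs l + 1) * (eps / (Rabs l + 1))) with (pos eps) in H2
    by (field; lra).
  exact H2.
Qed.

Lemma within_comp_locally_2d (J : R -> Prop) (x y : R -> R) (t : R)
    (P : R -> R -> Prop) :
  filterlim x (within J (locally t)) (locally (x t)) ->
  filterlim y (within J (locally t)) (locally (y t)) ->
  locally_2d P (x t) (y t) ->
  within J (locally t) (fun s => P (x s) (y s)).
Proof.
  intros Hx Hy [d Hd].
  generalize (filter_and _ _ (proj1 (filterlim_locally _ _) Hx d)
                             (proj1 (filterlim_locally _ _) Hy d)).
  apply filter_imp; intros s [H1 H2]; exact (Hd _ _ H1 H2).
Qed.

(** The error is the remainder of [h] plus the remainders of [x] and [y] weighted by [hx] and [hy];
    each of the two parts gets half of [eps]. The sum, product and composition rules below are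
    instances. *)
Lemma is_derive_within_comp_2d (J : R -> Prop) (h : R -> R -> R) (x y : R -> R)
    (t hx hy lx ly : R) :
  J t -> is_derive_within J x t lx -> is_derive_within J y t ly ->
  differentiable_pt_lim h (x t) (y t) hx hy ->
  is_derive_within J (fun s => h (x s) (y s)) t (hx * lx + hy * ly).
Proof.
  intros Jt Hx Hy Hh; apply is_derive_withinP; [exact Jt|]; intros eps.
  (* [M] dominates the Lipschitz constants [Rabs lx + 1] and [Rabs ly + 1] of both components. *)
  set (M := Rabs lx + Rabs ly + 1).
  assert (Px := Rabs_pos lx); assert (Py := Rabs_pos ly).
  assert (Pa := Rabs_pos hx); assert (Pb := Rabs_pos hy).
  assert (He := cond_pos eps).
  assert (PM : 0 < M) by (unfold M; lra).
  (* The summand 1 keeps [N] positive even when both partial derivatives vanish. *)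
  set (N := Rabs hx + Rabs hy + 1).
  assert (PN : 0 < N) by (unfold N; lra).
  assert (E2 : 0 < eps / 2 / M) by (apply Rdiv_lt_0_compat; lra).
  assert (E1 : 0 < eps / 2 / N) by (apply Rdiv_lt_0_compat; lra).
  generalize (filter_and _ _
    (filter_and _ _ (is_derive_within_lipschitz _ _ _ _ Jt Hx)
                    (is_derive_within_lipschitz _ _ _ _ Jt Hy))
    (filter_and _ _
      (within_comp_locally_2d J x y t _
        (is_derive_within_continuous _ _ _ _ Jt Hx)
        (is_derive_within_continuous _ _ _ _ Jt Hy) (Hh (mkposreal _ E2)))
      (filter_and _ _
        (proj1 (is_derive_withinP _ _ _ _ Jt) Hx (mkposreal _ E1))
        (proj1 (is_derive_withinP _ _ _ _ Jt) Hy (mkposreal _ E1))))).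
  apply filter_imp; intros s [[Lx Ly] [H [Dx Dy]]]; simpl in H, Dx, Dy.
  set (d := Rabs (s - t)) in *.
  assert (Pd : 0 <= d) by apply Rabs_pos.
  assert (HM : Rmax (Rabs (x s - x t)) (Rabs (y s - y t)) <= M * d).
  { apply Rmax_lub; eapply Rle_trans; [exact Lx | | exact Ly |];
      apply Rmult_le_compat_r; unfold M; lra. }
  replace (h (x s) (y s) - h (x t) (y t) - (s - t) * (hx * lx + hy * ly)) with
    ((h (x s) (y s) - h (x t) (y t) - (hx * (x s - x t) + hy * (y s - y t)))
     + (hx * (x s - x t - (s - t) * lx) + hy * (y s - y t - (s - t) * ly)))
    by ring.
  eapply Rle_trans; [apply Rabs_triang|].
  replace (eps * d) with (eps / 2 / M * (M * d) + N * (eps / 2 / N * d))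
    by (field; lra).
  apply Rplus_le_compat.
  - eapply Rle_trans; [exact H|]; apply Rmult_le_compat_l; lra.
  - eapply Rle_trans; [apply Rabs_triang|]; rewrite !Rabs_mult.
    assert (0 <= eps / 2 / N * d) by (apply Rmult_le_pos; lra).
    apply (Rmult_le_compat_l _ _ _ Pa) in Dx.
    apply (Rmult_le_compat_l _ _ _ Pb) in Dy.
    unfold N at 1; lra.
Qed.

(** * Clamping onto a segment: mean value theorem and integrals *)

Lemma interval_segment (J : R -> Prop) (r s : R) :
  is_interval J -> J r -> J s ->
  forall z, Rmin r s <= z <= Rmax r s -> J z.
Proof.
  intros HJ Jr Js z Hz; destruct (Rle_dec r s) as [H|H].
  - rewrite Rmin_left, Rmax_right in Hz by lra; exact (HJ r z s Jr Js Hz).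
  - rewrite Rmin_right, Rmax_left in Hz by lra; exact (HJ s z r Js Jr Hz).
Qed.

(** For [r <= s] this is the nearest-point retraction of the line onto the segment from [r] to
    [s]. *)
Definition clamp (r s z : R) : R := Rmax r (Rmin s z).

Lemma clamp_in (r s z : R) : r <= s -> r <= clamp r s z <= s.
Proof.
  intros H; unfold clamp, Rmax, Rmin.
  destruct (Rle_dec s z); destruct (Rle_dec _ _); lra.
Qed.

Lemma clamp_id (r s z : R) : r <= z <= s -> clamp r s z = z.
Proof. intros H; unfold clamp; rewrite Rmin_right, Rmax_right; lra. Qed.

Lemma clamp_contract (r s z w : R) :
  Rabs (clamp r s z - clamp r s w) <= Rabs (z - w).
Proof.
  unfold clamp, Rmax, Rmin, Rabs.
  destruct (Rle_dec s z), (Rle_dec s w);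
  repeat destruct (Rle_dec _ _); repeat destruct (Rcase_abs _); lra.
Qed.

(** The clamp is 1-Lipschitz with values in [J], so it sends a ball into the trace on [J] of a ball
    of the same radius; relative continuity thus becomes two-sided continuity on the whole line. *)
Lemma continuous_clamp (J : R -> Prop) (f : R -> R) (r s : R) :
  r <= s -> (forall z, r <= z <= s -> J z) ->
  (forall z, r <= z <= s -> filterlim f (within J (locally z)) (locally (f z))) ->
  forall z, continuous (fun w => f (clamp r s w)) z.
Proof.
  intros Hrs HJ Hf z.
  apply (filterlim_comp _ _ _ (clamp r s) f _ (within J (locally (clamp r s z)))).
  - intros P [d Hd]; exists d; intros w Hw.
    apply Hd; [|apply HJ, clamp_in, Hrs].
    apply Rle_lt_trans with (1 := clamp_contract r s w z); exact Hw.
  - apply Hf, clamp_in, Hrs.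
Qed.

Lemma is_derive_within_0_const (J : R -> Prop) (f : R -> R) :
  is_interval J -> (forall t, J t -> is_derive_within J f t 0) ->
  forall r s, J r -> J s -> f r = f s.
Proof.
  intros HJ Hf.
  assert (H : forall r s, r < s -> J r -> J s -> f r = f s).
  { intros r s Hrs Jr Js.
    assert (Jz : forall z, r <= z <= s -> J z) by (intros z; now apply HJ).
    (* The clamped function equals [f] on the segment, is continuous everywhere, and has two-sided
       derivative 0 at interior points. *)
    destruct (MVT_gen (fun w => f (clamp r s w)) r s (fun _ => 0)) as [c [_ Hc]].
    - rewrite Rmin_left, Rmax_right by lra; intros z Hz.
      assert (L : locally z (fun w => r < w < s)).
      { apply (locally_interval _ z r s); simpl; auto; lra. }
      apply is_derive_ext_loc with f.
      + revert L; apply filter_imp; intros w Hw; rewrite clamp_id; lra.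
      + apply is_derive_of_within with J; [|apply Hf, Jz; lra].
        revert L; apply filter_imp; intros w Hw; apply Jz; lra.
    - intros z _; apply continuity_pt_filterlim.
      apply (continuous_clamp J); [lra | exact Jz |].
      intros w Hw; apply is_derive_within_continuous with 0; auto.
    - rewrite !clamp_id in Hc by lra; lra. }
  intros r s Jr Js; destruct (Rtotal_order r s) as [h|[->|h]]; auto.
  symmetry; auto.
Qed.

Lemma ex_RInt_continuous_on (I : R -> Prop) (f : R -> R) (r s : R) :
  is_interval I -> continuous_on I f -> I r -> I s -> ex_RInt f r s.
Proof.
  intros HI Hf Ir Is.
  assert (Hm : Rmin r s <= Rmax r s) by apply Rminmax.
  assert (Iz := interval_segment I r s HI Ir Is).
  apply ex_RInt_ext with (fun w => f (clamp (Rmin r s) (Rmax r s) w)).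
  - intros z Hz; rewrite clamp_id; lra.
  - apply (ex_RInt_continuous (V := R_CompleteNormedModule)); intros z _.
    apply (continuous_clamp I); auto.
Qed.

(** The remainder is the integral of [f - f t] from [t] to [s]. Every point between [t] and [s] lies
    in [I] and is no farther from [t] than [s], so the integrand is bounded by [eps] there. *)
Lemma is_derive_within_RInt (I : R -> Prop) (f : R -> R) (a t : R) :
  is_interval I -> continuous_on I f -> I a -> I t ->
  is_derive_within I (fun s => RInt f a s) t (f t).
Proof.
  intros HI Hf Ia It; apply is_derive_withinP; [exact It|]; intros eps.
  destruct (proj1 (filterlim_locally _ _) (Hf t It) eps) as [d Hd].
  exists d; intros s Hs Is; change (Rabs (s - t) < d) in Hs.
  assert (E := ex_RInt_continuous_on I f a t HI Hf Ia It).
  assert (E' := ex_RInt_continuous_on I f t s HI Hf It Is).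
  rewrite <- (RInt_Chasles f a t s E E').
  change (plus (RInt f a t) (RInt f t s)) with (RInt f a t + RInt f t s).
  assert (K : is_RInt (fun z => minus (f z) (f t)) t s
                (minus (RInt f t s) (scal (s - t) (f t)))).
  { apply (@is_RInt_minus R_NormedModule f (fun _ => f t)).
    - exact (RInt_correct f t s E').
    - apply (@is_RInt_const R_NormedModule). }
  replace (RInt f a t + RInt f t s - RInt f a t - (s - t) * f t) with
    (RInt f t s - (s - t) * f t) by ring.
  rewrite (Rmult_comm eps).
  refine (norm_RInt_le_const_abs _ t s _ eps _ K).
  intros z Hz.
  apply Rlt_le, Hd; [|exact (interval_segment I t s HI It Is z Hz)].
  apply Rle_lt_trans with (2 := Hs).
  change (Rabs (z - t) <= Rabs (s - t)).
  revert Hz; unfold Rmin, Rmax, Rabs; destruct (Rle_dec t s);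
    repeat destruct (Rcase_abs _); lra.
Qed.

(** * Differentiation rules for relative derivatives *)

Lemma differentiable_pt_lim_plus (x y : R) :
  differentiable_pt_lim Rplus x y 1 1.
Proof.
  intros eps; exists (mkposreal 1 Rlt_0_1); intros u v _ _.
  replace (u + v - (x + y) - (1 * (u - x) + 1 * (v - y))) with 0 by ring.
  rewrite Rabs_R0; apply Rmult_le_pos; [apply Rlt_le, cond_pos|].
  apply Rle_trans with (2 := Rmax_l _ _); apply Rabs_pos.
Qed.

Lemma differentiable_pt_lim_mult (x y : R) :
  differentiable_pt_lim Rmult x y y x.
Proof.
  intros eps; exists eps; intros u v Hu Hv.
  replace (u * v - x * y - (y * (u - x) + x * (v - y))) with
    ((u - x) * (v - y)) by ring.
  rewrite Rabs_mult; apply Rmult_le_compat; try apply Rabs_pos.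
  - lra.
  - apply Rmax_r.
Qed.

Lemma is_derive_within_plus (J : R -> Prop) (f g : R -> R) (t lf lg : R) :
  J t -> is_derive_within J f t lf -> is_derive_within J g t lg ->
  is_derive_within J (fun s => f s + g s) t (lf + lg).
Proof.
  intros Jt Hf Hg.
  replace (lf + lg) with (1 * lf + 1 * lg) by ring.
  apply (is_derive_within_comp_2d J Rplus); auto.
  apply differentiable_pt_lim_plus.
Qed.

Lemma is_derive_within_mult (J : R -> Prop) (f g : R -> R) (t lf lg : R) :
  J t -> is_derive_within J f t lf -> is_derive_within J g t lg ->
  is_derive_within J (fun s => f s * g s) t (lf * g t + f t * lg).
Proof.
  intros Jt Hf Hg.
  replace (lf * g t + f t * lg) with (g t * lf + f t * lg) by ring.
  apply (is_derive_within_comp_2d J Rmult); auto.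
  apply differentiable_pt_lim_mult.
Qed.

Lemma is_derive_within_const (J : R -> Prop) (c t : R) :
  J t -> is_derive_within J (fun _ => c) t 0.
Proof.
  intros Jt; apply is_derive_within_of_is_derive; [exact Jt|].
  apply (@is_derive_const R_AbsRing R_NormedModule).
Qed.

Lemma is_derive_within_comp (J : R -> Prop) (h f : R -> R) (t l m : R) :
  J t -> is_derive h (f t) m -> is_derive_within J f t l ->
  is_derive_within J (fun s => h (f s)) t (m * l).
Proof.
  intros Jt Hh Hf.
  (* [h] is read as a function of two variables whose second partial derivative is 0. *)
  replace (m * l) with (m * l + 0 * l) by ring.
  apply (is_derive_within_comp_2d J (fun p _ => h p) f f); auto.
  now apply differentiable_pt_lim_proj1_0, is_derive_Reals.
Qed.

Lemma is_derive_within_opp (J : R -> Prop) (f : R -> R) (t l : R) :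
  J t -> is_derive_within J f t l -> is_derive_within J (fun s => - f s) t (- l).
Proof.
  intros Jt Hf; replace (- l) with (- (1) * l) by ring.
  apply (is_derive_within_comp J Ropp); auto.
  auto_derive; [exact Logic.I | ring].
Qed.

Lemma is_derive_within_exp (J : R -> Prop) (f : R -> R) (t l : R) :
  J t -> is_derive_within J f t l ->
  is_derive_within J (fun s => exp (f s)) t (exp (f t) * l).
Proof.
  intros Jt Hf; apply (is_derive_within_comp J exp); auto.
  apply is_derive_exp.
Qed.

Lemma continuous_on_of_derive_within (I : R -> Prop) (f df : R -> R) :
  (forall t, I t -> is_derive_within I f t (df t)) -> continuous_on I f.
Proof.
  intros Hf t It; apply is_derive_within_continuous with (df t); auto.
Qed.

Lemma continuous_on_mult (I : R -> Prop) (f g : R -> R) :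
  continuous_on I f -> continuous_on I g -> continuous_on I (fun t => f t * g t).
Proof.
  intros Hf Hg t It.
  refine (filterlim_comp_2 _ _ _ (Hf t It) (Hg t It) _).
  exact (@filterlim_mult R_AbsRing (f t) (g t)).
Qed.

Lemma exp_mul_exp_opp (z : R) : exp z * exp (- z) = 1.
Proof. now rewrite <- exp_plus, Rplus_opp_r, exp_0. Qed.

(** * Explicit solution of the linear system *)

Section LinearSystem.

Variables (I : R -> Prop) (a : R) (bA bB : R -> R).
Hypotheses (hI : is_interval I) (ha : I a)
  (hbA : continuous_on I bA) (hbB : continuous_on I bB).

Let G (t : R) : R := RInt (fun s => exp (gam bA a s) * bB s) a t.

Lemma is_derive_within_gam (t : R) :
  I t -> is_derive_within I (gam bA a) t (bA t).
Proof. intros It; now apply is_derive_within_RInt. Qed.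

Lemma is_derive_within_forcing (t : R) :
  I t -> is_derive_within I G t (exp (gam bA a t) * bB t).
Proof.
  intros It.
  apply (is_derive_within_RInt I (fun s => exp (gam bA a s) * bB s)); auto.
  apply continuous_on_mult; [|exact hbB].
  apply continuous_on_of_derive_within with
    (fun s => exp (gam bA a s) * bA s); intros s Is.
  now apply is_derive_within_exp, is_derive_within_gam.
Qed.

Lemma solves_xy_sol (J : R -> Prop) (c1 c2 : R) :
  (forall t, J t -> I t) ->
  solves_xy bA bB J (x_sol bA a c1) (y_sol bA bB a c2).
Proof.
  intros JI t Jt; assert (It := JI t Jt).
  assert (Hg := is_derive_within_gam t It).
  assert (E := exp_mul_exp_opp (gam bA a t)).
  split; apply is_derive_within_subset with I; auto.
  - replace (bA t * x_sol bA a c1 t) with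
      (0 * exp (gam bA a t) + c1 * (exp (gam bA a t) * bA t))
      by (unfold x_sol; ring).
    apply (is_derive_within_mult I (fun _ => c1) (fun s => exp (gam bA a s))); auto.
    + now apply is_derive_within_const.
    + now apply is_derive_within_exp.
  - replace (- bA t * y_sol bA bB a c2 t + bB t) with
      ((0 + exp (gam bA a t) * bB t) * exp (- gam bA a t)
       + (c2 + G t) * (exp (- gam bA a t) * - bA t)).
    + apply (is_derive_within_mult I (fun s => c2 + G s)
        (fun s => exp (- gam bA a s))); auto.
      * apply (is_derive_within_plus I (fun _ => c2)); auto.
        -- now apply is_derive_within_const.
        -- now apply is_derive_within_forcing.
      * apply (is_derive_within_exp I (fun s => - gam bA a s)); auto.
        now apply (is_derive_within_opp I (gam bA a)).
    + unfold y_sol; fold (G t).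
      transitivity (bB t * (exp (gam bA a t) * exp (- gam bA a t))
        - bA t * ((c2 + G t) * exp (- gam bA a t))); [ring|].
      rewrite E; ring.
Qed.

(** Solving the formulas for [x_sol] and [y_sol] for the constants gives two functions [X] and [Y]
    of time; along any solution their derivatives are 0, so they are constant on the interval
    [J]. *)
Lemma solves_xy_general (J : R -> Prop) (x y : R -> R) :
  is_interval J -> (forall t, J t -> I t) -> solves_xy bA bB J x y ->
  exists c1 c2 : R, forall t, J t ->
    x t = x_sol bA a c1 t /\ y t = y_sol bA bB a c2 t.
Proof.
  intros HJ JI Hxy.
  destruct (classic (exists t0, J t0)) as [[t0 J0]|nJ].
  (* On an empty [J] any constants will do. *)
  2: { exists 0, 0; intros t Jt; exfalso; eauto. }
  assert (Hg : forall t, J t -> is_derive_within J (gam bA a) t (bA t)).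
  { intros t Jt; apply is_derive_within_subset with I; auto.
    apply is_derive_within_gam; auto. }
  set (X := fun t => x t * exp (- gam bA a t)).
  set (Y := fun t => y t * exp (gam bA a t) + - G t).
  assert (HX : forall t, J t -> is_derive_within J X t 0).
  { intros t Jt; destruct (Hxy t Jt) as [Hx _].
    replace 0 with (bA t * x t * exp (- gam bA a t)
      + x t * (exp (- gam bA a t) * - bA t)) by ring.
    apply (is_derive_within_mult J x (fun s => exp (- gam bA a s))); auto.
    apply (is_derive_within_exp J (fun s => - gam bA a s)); auto.
    apply (is_derive_within_opp J (gam bA a)); auto. }
  assert (HY : forall t, J t -> is_derive_within J Y t 0).
  { intros t Jt; destruct (Hxy t Jt) as [_ Hy].
    replace 0 with ((- bA t * y t + bB t) * exp (gam bA a t)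
      + y t * (exp (gam bA a t) * bA t) + - (exp (gam bA a t) * bB t)) by ring.
    apply (is_derive_within_plus J (fun s => y s * exp (gam bA a s))
             (fun s => - G s)); auto.
    - apply (is_derive_within_mult J y (fun s => exp (gam bA a s))); auto.
      apply (is_derive_within_exp J (gam bA a)); auto.
    - apply (is_derive_within_opp J G); auto.
      apply is_derive_within_subset with I; auto.
      apply is_derive_within_forcing; auto. }
  (* The constants are the values at a base point, which equal the values at any other [t] in
     [J]. *)
  exists (X t0), (Y t0); intros t Jt.
  rewrite (is_derive_within_0_const J X HJ HX t0 t J0 Jt).
  rewrite (is_derive_within_0_const J Y HJ HY t0 t J0 Jt).
  assert (E := exp_mul_exp_opp (gam bA a t)).
  unfold x_sol, y_sol, X, Y; fold (G t); split.
  - rewrite Rmult_assoc, (Rmult_comm (exp _)), E; ring.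
  - transitivity (y t * (exp (gam bA a t) * exp (- gam bA a t))); [|ring].
    rewrite E; ring.
Qed.

End LinearSystem.

(** * Differentiability of smooth functions of two variables *)

(** Differentiability follows from the existence of the first partial derivative near the point, its
    continuity there, and the existence of the second one at the point; [ex_diff_n] of order 1
    provides all three. *)
Lemma smooth_differentiable (W : R * R -> Prop) (g : R -> R -> R) (x y : R) :
  open W -> W (x, y) ->
  (forall (n : nat) (u v : R), W (u, v) -> ex_diff_n g n u v) ->
  differentiable_pt_lim g x y (d_u g x y) (d_v g x y).
Proof.
  intros oW Wxy Hg; apply filterdiff_differentiable_pt_lim.
  apply (is_derive_filterdiff g x y (d_u g) (d_v g x y)).
  - generalize (oW _ Wxy); apply filter_imp; intros [u v] Wuv; simpl.
    apply Derive_correct, (Hg 1%nat u v Wuv).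
  - apply Derive_correct, (Hg 1%nat x y Wxy).
  - apply continuity_2d_pt_filterlim.
    destruct (Hg 1%nat x y Wxy) as [_ [_ [_ [[H _] _]]]]; exact H.
Qed.

(** When [A] is not known to be open, the values of [f] off [A] are arbitrary and [f] may have no
    partial derivatives; the chain rule is then applied to [g]. *)
Lemma smooth_on_extension (A : R * R -> Prop) (f : R -> R -> R) (x y : R) :
  smooth_on A f -> A (x, y) ->
  exists g : R -> R -> R,
    differentiable_pt_lim g x y (d_u g x y) (d_v g x y) /\
    locally_2d (fun u v => A (u, v) -> f u v = g u v) x y.
Proof.
  intros Hf Axy; destruct (Hf _ Axy) as [W [g [oW [Wxy [Hg Hfg]]]]].
  exists g; split; [now apply smooth_differentiable with W|].
  apply locally_2d_locally.
  generalize (oW _ Wxy); apply filter_imp; intros [u v]; apply Hfg.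
Qed.

(** On an open set the local extension agrees with [f] in a full neighbourhood, so its partial
    derivatives are those of [f]. *)
Lemma smooth_on_open_differentiable (U : R * R -> Prop) (f : R -> R -> R) (x y : R) :
  open U -> smooth_on U f -> U (x, y) ->
  differentiable_pt_lim f x y (d_u f x y) (d_v f x y).
Proof.
  intros oU Hf Uxy.
  destruct (smooth_on_extension U f x y Hf Uxy) as [g [Hg Hfg]].
  assert (Hf' : differentiable_pt_lim f x y (d_u g x y) (d_v g x y)).
  { apply differentiable_pt_lim_ext with g; [|exact Hg].
    apply locally_2d_locally.
    generalize (filter_and _ _ (oU _ Uxy) (proj1 (locally_2d_locally _ _ _) Hfg)).
    apply filter_imp; intros [u v] [Huv H]; symmetry; exact (H Huv). }
  destruct (differentiable_pt_lim_unique _ _ _ _ _ Hf') as [Eu Ev].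
  unfold d_u at 1, d_v at 1; rewrite Eu, Ev; exact Hf'.
Qed.

Lemma differentiable_pt_lim_unique_values (f : R -> R -> R) (x y a b c d : R) :
  differentiable_pt_lim f x y a b -> differentiable_pt_lim f x y c d ->
  a = c /\ b = d.
Proof.
  intros H1 H2.
  destruct (differentiable_pt_lim_unique _ _ _ _ _ H1) as [<- <-].
  now destruct (differentiable_pt_lim_unique _ _ _ _ _ H2) as [<- <-].
Qed.

Lemma differentiable_pt_lim_fst (x y : R) :
  differentiable_pt_lim (fun u _ => u) x y 1 0.
Proof.
  apply differentiable_pt_lim_proj1_0 with (f := fun u => u).
  apply derivable_pt_lim_id.
Qed.

Lemma differentiable_pt_lim_snd (x y : R) :
  differentiable_pt_lim (fun _ v => v) x y 0 1.
Proof.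
  intros eps; exists (mkposreal 1 Rlt_0_1); intros u v _ _.
  replace (v - y - (0 * (u - x) + 1 * (v - y))) with 0 by ring.
  rewrite Rabs_R0; apply Rmult_le_pos; [apply Rlt_le, cond_pos|].
  apply Rle_trans with (2 := Rmax_l _ _); apply Rabs_pos.
Qed.

(** * The Jacobian of the diffeomorphism and the change of coordinates *)

Section Diffeomorphism.

Variables (U : R * R -> Prop) (phi1 phi2 psi1 psi2 : R -> R -> R).
Hypothesis hPhi : diffeo_onto_image U phi1 phi2 psi1 psi2.

Lemma diffeo_differentiable (u v : R) :
  U (u, v) ->
  differentiable_pt_lim phi1 u v (d_u phi1 u v) (d_v phi1 u v) /\
  differentiable_pt_lim phi2 u v (d_u phi2 u v) (d_v phi2 u v).
Proof.
  intros Uuv; destruct hPhi as [oU [H1 [H2 _]]].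
  split; now apply smooth_on_open_differentiable with U.
Qed.

Lemma image2_intro (u v : R) : U (u, v) -> image2 U phi1 phi2 (phi1 u v, phi2 u v).
Proof. intros Uuv; now exists u, v. Qed.

(* The image need not be assumed open: the chain rule is applied to smooth extensions
   [g1], [g2] of the inverse, which satisfy [g o Phi = id] near [(u, v)]. *)
Lemma diffeo_local_inverse (u v : R) :
  U (u, v) ->
  exists (g1 g2 : R -> R -> R) (g1x g1y g2x g2y : R),
    differentiable_pt_lim g1 (phi1 u v) (phi2 u v) g1x g1y /\
    differentiable_pt_lim g2 (phi1 u v) (phi2 u v) g2x g2y /\
    locally_2d (fun x y => image2 U phi1 phi2 (x, y) ->
                  psi1 x y = g1 x y /\ psi2 x y = g2 x y) (phi1 u v) (phi2 u v) /\
    g1x * d_u phi1 u v + g1y * d_u phi2 u v = 1 /\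
    g1x * d_v phi1 u v + g1y * d_v phi2 u v = 0 /\
    g2x * d_u phi1 u v + g2y * d_u phi2 u v = 0 /\
    g2x * d_v phi1 u v + g2y * d_v phi2 u v = 1.
Proof.
  intros Uuv; assert (Iuv := image2_intro u v Uuv).
  destruct (diffeo_differentiable u v Uuv) as [D1 D2].
  destruct hPhi as [oU [_ [_ [S1 [S2 Hinv]]]]].
  destruct (smooth_on_extension _ _ _ _ S1 Iuv) as [g1 [G1 L1]].
  destruct (smooth_on_extension _ _ _ _ S2 Iuv) as [g2 [G2 L2]].
  assert (L : locally_2d (fun x y => image2 U phi1 phi2 (x, y) ->
                psi1 x y = g1 x y /\ psi2 x y = g2 x y) (phi1 u v) (phi2 u v)).
  { generalize (locally_2d_and _ _ _ _ L1 L2); apply locally_2d_impl.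
    apply locally_2d_forall; intros x y [h1 h2] h; auto. }
  assert (C1 := differentiable_pt_lim_comp _ _ _ _ _ _ _ _ _ _ _ G1 D1 D2).
  assert (C2 := differentiable_pt_lim_comp _ _ _ _ _ _ _ _ _ _ _ G2 D1 D2).
  (* By continuity, [Phi] sends points near [(u, v)] to image points near [Phi (u, v)], where [g1],
     [g2] agree with [psi1], [psi2]. *)
  assert (N : locally_2d (fun s t =>
     s = g1 (phi1 s t) (phi2 s t) /\ t = g2 (phi1 s t) (phi2 s t)) u v).
  { assert (K : locally_2d (fun s t => image2 U phi1 phi2 (phi1 s t, phi2 s t) ->
       psi1 (phi1 s t) (phi2 s t) = g1 (phi1 s t) (phi2 s t) /\
       psi2 (phi1 s t) (phi2 s t) = g2 (phi1 s t) (phi2 s t)) u v).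
    { destruct L as [d Hd].
      assert (K1 := differentiable_continuity_pt phi1 u v
                      (ex_intro _ _ (ex_intro _ _ D1)) d).
      assert (K2 := differentiable_continuity_pt phi2 u v
                      (ex_intro _ _ (ex_intro _ _ D2)) d).
      generalize (locally_2d_and _ _ _ _ K1 K2); apply locally_2d_impl.
      apply locally_2d_forall; intros s t [h1 h2]; now apply Hd. }
    apply locally_2d_locally.
    generalize (filter_and _ _ (oU _ Uuv) (proj1 (locally_2d_locally _ _ _) K)).
    apply filter_imp; intros [s t] [Ust H]; simpl in *.
    destruct (H (image2_intro s t Ust)) as [<- <-].
    destruct (Hinv s t Ust); auto. }
  assert (E1 : locally_2d (fun s t => s = g1 (phi1 s t) (phi2 s t)) u v).
  { revert N; apply locally_2d_impl, locally_2d_forall; tauto. }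
  assert (E2 : locally_2d (fun s t => t = g2 (phi1 s t) (phi2 s t)) u v).
  { revert N; apply locally_2d_impl, locally_2d_forall; tauto. }
  assert (F1 := differentiable_pt_lim_ext _ _ _ _ _ _ E1
                  (differentiable_pt_lim_fst u v)).
  assert (F2 := differentiable_pt_lim_ext _ _ _ _ _ _ E2
                  (differentiable_pt_lim_snd u v)).
  (* Uniqueness of the differential: the chain rule coefficients are those of the coordinate
     functions, which gives the four equations. *)
  destruct (differentiable_pt_lim_unique_values _ _ _ _ _ _ _ C1 F1).
  destruct (differentiable_pt_lim_unique_values _ _ _ _ _ _ _ C2 F2).
  eexists g1, g2, _, _, _, _; split; [exact G1|]; split; [exact G2|]; auto.
Qed.

(** The four equations say that the Jacobian matrix of [(g1, g2)] times that of [Phi] is the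
    identity; taking determinants exhibits an inverse of [Xi]. *)
Lemma Xi_neq_0 (u v : R) : U (u, v) -> Xi phi1 phi2 u v <> 0.
Proof.
  intros Uuv.
  destruct (diffeo_local_inverse u v Uuv)
    as [g1 [g2 [a [b [c [d [_ [_ [_ [e1 [e2 [e3 e4]]]]]]]]]]]].
  assert (E : (a * d - b * c) * Xi phi1 phi2 u v = 1).
  { unfold Xi.
    transitivity ((a * d_u phi1 u v + b * d_u phi2 u v)
      * (c * d_v phi1 u v + d * d_v phi2 u v)
      - (a * d_v phi1 u v + b * d_v phi2 u v)
      * (c * d_u phi1 u v + d * d_u phi2 u v)); [ring|].
    rewrite e1, e2, e3, e4; ring. }
  intros H; rewrite H in E; lra.
Qed.

(** Cramer's rule: [rhs_u], [rhs_v] solve the linear equations whose matrix is the Jacobian of [Phi]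
    and whose right-hand side is the linear vector field. This is the first row. *)
Lemma jacobian_rhs1 (bA bB : R -> R) (t u v : R) :
  U (u, v) ->
  d_u phi1 u v * rhs_u phi1 phi2 bA bB t u v
  + d_v phi1 u v * rhs_v phi1 phi2 bA bB t u v = bA t * phi1 u v.
Proof.
  intros Uuv; assert (H := Xi_neq_0 u v Uuv); unfold rhs_u, rhs_v.
  replace (bA t * phi1 u v) with
    (bA t * phi1 u v * Xi phi1 phi2 u v / Xi phi1 phi2 u v) by (field; exact H).
  (* Only the numerator is expanded; the denominators stay the atom [Xi], known to be nonzero. *)
  unfold Xi at 5; field; exact H.
Qed.

Lemma jacobian_rhs2 (bA bB : R -> R) (t u v : R) :
  U (u, v) ->
  d_u phi2 u v * rhs_u phi1 phi2 bA bB t u v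
  + d_v phi2 u v * rhs_v phi1 phi2 bA bB t u v = - bA t * phi2 u v + bB t.
Proof.
  intros Uuv; assert (H := Xi_neq_0 u v Uuv); unfold rhs_u, rhs_v.
  replace (- bA t * phi2 u v + bB t) with
    ((- bA t * phi2 u v + bB t) * Xi phi1 phi2 u v / Xi phi1 phi2 u v)
    by (field; exact H).
  unfold Xi at 5; field; exact H.
Qed.

(** From [(u, v)] to [(x, y)] this is the chain rule for [Phi]. Conversely, near each time [u] and
    [v] are smooth local extensions of the inverse evaluated along [(x, y)], so their
    differentiability is a consequence and not an assumption. *)
Lemma solves_xy_iff_uv (bA bB : R -> R) (J : R -> Prop) (u v : R -> R) :
  (forall t, J t -> U (u t, v t)) ->
  (solves_xy bA bB J
     (fun t => phi1 (u t) (v t)) (fun t => phi2 (u t) (v t))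
   <-> solves_uv U phi1 phi2 bA bB J u v).
Proof.
  intros HU; split.
  - intros Hxy t Jt; split; [auto|].
    destruct (Hxy t Jt) as [Hx Hy].
    assert (Ut := HU t Jt).
    destruct (diffeo_local_inverse _ _ Ut)
      as [g1 [g2 [p [q [r [w [G1 [G2 [L [e1 [e2 [e3 e4]]]]]]]]]]]].
    assert (N : within J (locally t) (fun s =>
       g1 (phi1 (u s) (v s)) (phi2 (u s) (v s)) = u s /\
       g2 (phi1 (u s) (v s)) (phi2 (u s) (v s)) = v s)).
    { generalize (within_comp_locally_2d J _ _ t _
        (is_derive_within_continuous _ _ _ _ Jt Hx)
        (is_derive_within_continuous _ _ _ _ Jt Hy) L).
      unfold within; apply filter_imp; intros s H Js.
      destruct (H Js (image2_intro _ _ (HU s Js))) as [<- <-].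
      now apply hPhi, HU. }
    (* The linear velocity is written as the Jacobian of [Phi] applied to [(rhs_u, rhs_v)], which
       the differential of [(g1, g2)] then cancels. *)
    rewrite <- (jacobian_rhs1 bA bB t _ _ Ut) in Hx.
    rewrite <- (jacobian_rhs2 bA bB t _ _ Ut) in Hy.
    assert (K1 := is_derive_within_comp_2d J g1 _ _ _ _ _ _ _ Jt Hx Hy G1).
    assert (K2 := is_derive_within_comp_2d J g2 _ _ _ _ _ _ _ Jt Hx Hy G2).
    split.
    + apply (is_derive_within_ext_loc J
        (fun s => g1 (phi1 (u s) (v s)) (phi2 (u s) (v s)))); [exact Jt| |].
      * revert N; apply filter_imp; tauto.
      * match type of K1 with is_derive_within _ _ _ ?l =>
          replace (rhs_u phi1 phi2 bA bB t (u t) (v t)) with l; [exact K1|] end.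
        transitivity ((p * d_u phi1 (u t) (v t) + q * d_u phi2 (u t) (v t))
             * rhs_u phi1 phi2 bA bB t (u t) (v t)
          + (p * d_v phi1 (u t) (v t) + q * d_v phi2 (u t) (v t))
             * rhs_v phi1 phi2 bA bB t (u t) (v t)); [ring|].
        rewrite e1, e2; ring.
    + apply (is_derive_within_ext_loc J
        (fun s => g2 (phi1 (u s) (v s)) (phi2 (u s) (v s)))); [exact Jt| |].
      * revert N; apply filter_imp; tauto.
      * match type of K2 with is_derive_within _ _ _ ?l =>
          replace (rhs_v phi1 phi2 bA bB t (u t) (v t)) with l; [exact K2|] end.
        transitivity ((r * d_u phi1 (u t) (v t) + w * d_u phi2 (u t) (v t))
             * rhs_u phi1 phi2 bA bB t (u t) (v t)
          + (r * d_v phi1 (u t) (v t) + w * d_v phi2 (u t) (v t))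
             * rhs_v phi1 phi2 bA bB t (u t) (v t)); [ring|].
        rewrite e3, e4; ring.
  - intros Huv t Jt; destruct (Huv t Jt) as [Ut [Hu Hv]].
    destruct (diffeo_differentiable _ _ Ut) as [D1 D2].
    rewrite <- (jacobian_rhs1 bA bB t _ _ Ut), <- (jacobian_rhs2 bA bB t _ _ Ut).
    split; now apply is_derive_within_comp_2d.
Qed.

Lemma image2_psi (x y : R) :
  image2 U phi1 phi2 (x, y) ->
  U (psi1 x y, psi2 x y) /\
  phi1 (psi1 x y) (psi2 x y) = x /\ phi2 (psi1 x y) (psi2 x y) = y.
Proof.
  intros [u [v [Uuv E]]]; injection E as -> ->.
  destruct hPhi as [_ [_ [_ [_ [_ Hinv]]]]].
  destruct (Hinv u v Uuv) as [-> ->]; auto.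
Qed.

End Diffeomorphism.

(** * General solution in the coordinates [(u, v)] and its constants *)

Theorem mainTheorem2
  (U : R * R -> Prop) (phi1 phi2 psi1 psi2 : R -> R -> R)
  (hPhi : diffeo_onto_image U phi1 phi2 psi1 psi2)
  (I : R -> Prop) (a : R) (bA bB : R -> R)
  (hI : is_interval I) (ha : I a)
  (hbA : continuous_on I bA) (hbB : continuous_on I bB) :
  (forall u v : R, U (u, v) -> Xi phi1 phi2 u v <> 0) /\
  (* the linear system, read in the coordinates (u, v) *)
  (forall (J : R -> Prop) (u v : R -> R),
     is_interval J -> (forall t, J t -> I t) ->
     (forall t, J t -> U (u t, v t)) ->
     (solves_xy bA bB J
        (fun t => phi1 (u t) (v t)) (fun t => phi2 (u t) (v t))
      <-> solves_uv U phi1 phi2 bA bB J u v)) /\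
  (* the general solution, on any interval where (x, y) stays in the image *)
  (forall (J : R -> Prop) (u v : R -> R),
     is_interval J -> (forall t, J t -> I t) ->
     (solves_uv U phi1 phi2 bA bB J u v
      <-> exists c1 c2 : R, forall t, J t ->
            image2 U phi1 phi2 (x_sol bA a c1 t, y_sol bA bB a c2 t) /\
            u t = psi1 (x_sol bA a c1 t) (y_sol bA bB a c2 t) /\
            v t = psi2 (x_sol bA a c1 t) (y_sol bA bB a c2 t))) /\
  (* the initial conditions determine the constants *)
  (forall t0 u0 v0 : R, I t0 -> U (u0, v0) ->
     exists! c : R * R,
       image2 U phi1 phi2 (x_sol bA a (fst c) t0, y_sol bA bB a (snd c) t0) /\
       psi1 (x_sol bA a (fst c) t0) (y_sol bA bB a (snd c) t0) = u0 /\
       psi2 (x_sol bA a (fst c) t0) (y_sol bA bB a (snd c) t0) = v0).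
Proof.
  assert (Hinv := proj2 (proj2 (proj2 (proj2 (proj2 hPhi))))).
  split; [|split; [|split]].
  - exact (Xi_neq_0 U phi1 phi2 psi1 psi2 hPhi).
  - intros J u v _ _ HU; now apply solves_xy_iff_uv with psi1 psi2.
  - intros J u v HJ JI; split.
    + intros Huv.
      assert (HU : forall t, J t -> U (u t, v t)) by (intros t Jt; now apply Huv).
      apply (solves_xy_iff_uv U phi1 phi2 psi1 psi2 hPhi bA bB J u v HU) in Huv.
      destruct (solves_xy_general I a bA bB hI ha hbA hbB J _ _ HJ JI Huv)
        as [c1 [c2 H]].
      exists c1, c2; intros t Jt; destruct (H t Jt) as [<- <-].
      destruct (Hinv _ _ (HU t Jt)) as [-> ->].
      split; [now apply image2_intro, HU | auto].
    + intros [c1 [c2 H]].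
      (* Since the explicit curve stays in the image, applying [Phi] to [u], [v] recovers [x_sol]
         and [y_sol]. *)
      assert (HU : forall t, J t -> U (u t, v t) /\
        x_sol bA a c1 t = phi1 (u t) (v t) /\
        y_sol bA bB a c2 t = phi2 (u t) (v t)).
      { intros t Jt; destruct (H t Jt) as [Im [-> ->]].
        destruct (image2_psi U phi1 phi2 psi1 psi2 hPhi _ _ Im) as [h [-> ->]].
        auto. }
      apply (solves_xy_iff_uv U phi1 phi2 psi1 psi2 hPhi);
        [intros t Jt; now apply HU|].
      intros t Jt; destruct (HU t Jt) as [_ [<- <-]].
      destruct (solves_xy_sol I a bA bB hI ha hbA hbB J c1 c2 JI t Jt) as [Hx Hy].
      split; [revert Hx | revert Hy];
        apply is_derive_within_ext; auto; intros s Js; now apply HU.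
  - intros t0 u0 v0 It0 HU0.
    assert (E := exp_mul_exp_opp (gam bA a t0)).
    set (G := RInt (fun s => exp (gam bA a s) * bB s) a t0).
    (* These constants solve [x_sol = phi1 u0 v0] and [y_sol = phi2 u0 v0] at time [t0]. *)
    exists (phi1 u0 v0 * exp (- gam bA a t0),
            phi2 u0 v0 * exp (gam bA a t0) - G); split.
    + simpl; unfold x_sol, y_sol; fold G.
      replace (phi1 u0 v0 * exp (- gam bA a t0) * exp (gam bA a t0))
        with (phi1 u0 v0)
        by (rewrite Rmult_assoc, (Rmult_comm (exp _)), E; ring).
      replace ((phi2 u0 v0 * exp (gam bA a t0) - G + G) * exp (- gam bA a t0))
        with (phi2 u0 v0)
        by (transitivity (phi2 u0 v0 * (exp (gam bA a t0) * exp (- gam bA a t0)));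
            [rewrite E; ring | ring]).
      split; [now apply image2_intro | now apply Hinv].
    + intros [c1 c2]; simpl; intros [Im [E1 E2]].
      (* Applying [Phi] to the initial conditions determines [x_sol] and [y_sol] at [t0], hence [c1]
         and [c2], as the exponential factors are invertible. *)
      destruct (image2_psi U phi1 phi2 psi1 psi2 hPhi _ _ Im) as [_ [F1 F2]].
      rewrite E1, E2 in F1, F2; rewrite F1, F2; unfold x_sol, y_sol; fold G.
      f_equal.
      * rewrite Rmult_assoc, E; ring.
      * transitivity ((c2 + G) * (exp (gam bA a t0) * exp (- gam bA a t0)) - G);
          [ring | rewrite E; ring].
Qed.
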